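(* The dynamics on $\mathbb{R}^{|S|}\times\mathbb{R}^{|S|\times|A|}_{>0}$ $$\frac{dv_{s'}}{dt}=-\Big(v_{s'}-\frac1\alpha\sum_{s,a}K_{ass'}u_{sa}\Big),\ s'\in S,\qquad \frac{du_{sa}}{dt}=-u_{sa}\Big(\log\frac{u_{sa}}{\tilde u_s}-\frac1\tau\Big(r_{sa}-\sum_{s'}K_{ass'}v_{s'}\Big)\Big),\ (s,a)\in S\times A,$$ converges to $(v^*,u^* )$ at rate $O(e^{-ct})$ for some $c>0$, where $(v^*,u^* )$ is the unique saddle point of $\min_v\max_u E(v,u)$.
   Context: Finite MDP: state space $S$, action space $A$, transition probabilities $P_{ass'}$ (with $\sum_{s'}P_{ass'}=1$), rewards $r_{sa}\ge0$, discount $\gamma\in(0,1)$, regularization $\tau>0$, and $\alpha>0$. $K_{ass'}=\delta_{ss'}-\gamma P_{ass'}$, $\tilde u_s=\sum_a u_{sa}$, and $E(v,u)=\frac{\alpha}{2}\sum_s v_s^2+\sum_{s,a}u_{sa}(r_{sa}-\sum_{s'}K_{ass'}v_{s'})-\tau\sum_{s,a}u_{sa}\log(u_{sa}/\tilde u_s)$. This min-max problem has a unique saddle point $(v^*,u^* )$. *)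

(* Defs.v *)
From HB Require Import structures.
From mathcomp Require Import all_boot all_order all_algebra.
From mathcomp Require Import all_classical all_reals all_analysis.
Set Implicit Arguments. Unset Strict Implicit. Unset Printing Implicit Defensive.
Import Order.TTheory GRing.Theory Num.Theory.
Local Open Scope ring_scope.

Section MDP.
Variables (R : realType) (S A : finType).

(* P s a s' = P_{a s s'} : probability of moving from s to s' under action a *)
Definition Kmat (gamma : R) (P : S -> A -> S -> R) (s : S) (a : A) (s' : S) : R :=
  (s == s')%:R - gamma * P s a s'.

Definition utilde (u : S -> A -> R) (s : S) : R := \sum_(a : A) u s a.

Definition Efun (alpha tau gamma : R) (P : S -> A -> S -> R) (r : S -> A -> R)
  (v : S -> R) (u : S -> A -> R) : R :=
  alpha / 2 * \sum_(s : S) v s ^+ 2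
  + \sum_(s : S) \sum_(a : A)
      u s a * (r s a - \sum_(s' : S) Kmat gamma P s a s' * v s')
  - tau * \sum_(s : S) \sum_(a : A) u s a * ln (u s a / utilde u s).

Definition posu (u : S -> A -> R) : Prop := forall s a, 0 < u s a.

Definition is_saddle (alpha tau gamma : R) (P : S -> A -> S -> R) (r : S -> A -> R)
  (vs : S -> R) (us : S -> A -> R) : Prop :=
  posu us /\
  (forall v, Efun alpha tau gamma P r vs us <= Efun alpha tau gamma P r v us) /\
  (forall u, posu u -> Efun alpha tau gamma P r vs u <= Efun alpha tau gamma P r vs us).

Definition vfield (alpha gamma : R) (P : S -> A -> S -> R)
  (v : S -> R) (u : S -> A -> R) (s' : S) : R :=
  - (v s' - alpha^-1 * \sum_(s : S) \sum_(a : A) Kmat gamma P s a s' * u s a).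

Definition ufield (tau gamma : R) (P : S -> A -> S -> R) (r : S -> A -> R)
  (v : S -> R) (u : S -> A -> R) (s : S) (a : A) : R :=
  - (u s a * (ln (u s a / utilde u s)
       - tau^-1 * (r s a - \sum_(s' : S) Kmat gamma P s a s' * v s'))).

End MDP.

(* Main.v *)
(**
Write [w = v - vs], [d = u - us], [y = ln pi - ln pi_s] where [pi] and [pi_s]
are the policies of [u] and [us], and [q = K^T d]. The first order conditions
at the saddle point turn the flow into [w' = - (w - q / alpha)], [u' = - u (y + K w / tau)], so that the
relative entropy
  [L = alpha / 2 |w|^2 + tau sum (u - us - us ln (u / us))]
satisfies [L' = - (alpha |w|^2 + tau sum d y)]. On a sublevel set of [L] the
entries of [u] stay in a compact part of the positive reals and
[sum d y >= const * |y|^2], but this dissipation does not see the marginals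
[sum_a d]. The cross term [- <w, q>] repairs this: its derivative contains
[- |q|^2 / alpha], and as the discount factor is less than 1, [q] and [y]
together control [d] in l1 norm. Hence [L - eps <w, q>] decays exponentially, at
a rate that depends only on the sublevel set; every trajectory enters the
sublevel set [L <= 1], which makes the rate uniform.
*)

Require Import Defs.
From HB Require Import structures.
From mathcomp Require Import all_boot all_order all_algebra.
From mathcomp Require Import all_classical all_reals all_analysis.
From mathcomp Require Import ring lra.
Import Order.TTheory GRing.Theory Num.Theory.
Local Open Scope ring_scope.

Ltac nonneg := repeat first [ by [] | exact: ltW | exact: sqr_ge0
  | apply: addr_ge0 | apply: divr_ge0 | apply: mulr_ge0 ].

(** * Scalar inequalities for the relative entropy and the exponential *)

Section ScalarInequalities.
Context {R : realType}.
Implicit Types x y z c : R.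

(** The Bregman divergence of [t ln t] with the reference point [x0] in the first slot. Its
    derivative in [x] is [1 - x0 / x], so that a velocity proportional to [u] yields the factor
    [u - us]. *)
Definition breg x x0 : R := x - x0 - x0 * ln (x / x0).

(** The substitution [x = x0 e^z] reduces bounds on [breg] to bounds on the convexity gap
    [e^z - 1 - z]. *)
Lemma bregE x x0 : 0 < x -> 0 < x0 ->
  exists2 z, x = x0 * expR z & breg x x0 = x0 * (expR z - 1 - z).
Proof.
move=> x_gt0 x0_gt0; exists (ln (x / x0)).
  by rewrite lnK ?posrE ?divr_gt0// mulrC divfK// gt_eqF.
rewrite /breg (_ : expR _ = x / x0); last by rewrite lnK ?posrE ?divr_gt0.
by rewrite !mulrBr mulrCA divff ?gt_eqF// !mulr1.
Qed.

Lemma breg_ge0 x x0 : 0 < x -> 0 < x0 -> 0 <= breg x x0.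
Proof.
move=> x_gt0 x0_gt0; have [z _ ->] := bregE x x0 x_gt0 x0_gt0.
by apply: mulr_ge0; [exact: ltW | have := expR_ge1Dx z; lra].
Qed.

(** After multiplication by [x >= c] and the substitution, the claim is
    [e^z (e^z - 1 - z) <= (e^z - 1)^2], which amounts to [1 - z <= e^(-z)]. *)
Lemma breg_le x x0 c : 0 < c -> c <= x -> 0 < x0 ->
  breg x x0 <= (x - x0) ^+ 2 / c.
Proof.
move=> c_gt0 cx x0_gt0; have x_gt0 : 0 < x by lra.
have [z xE ->] := bregE x x0 x_gt0 x0_gt0.
rewrite ler_pdivlMr// (@le_trans _ _ (x0 * (expR z - 1 - z) * x))//.
  apply: ler_wpM2l => //.
  by apply: mulr_ge0; [exact: ltW | have := expR_ge1Dx z; lra].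
rewrite xE (_ : (_ - _) ^+ 2 = x0 ^+ 2 * (expR z - 1) ^+ 2); last by ring.
rewrite (_ : _ * _ * _ = x0 ^+ 2 * (expR z * (expR z - 1 - z))); last by ring.
rewrite ler_pM2l ?exprn_gt0//.
have e_gt0 := expR_gt0 z.
have : expR z * (1 - z) <= expR z * expR (- z).
  by rewrite ler_pM2l//; have := expR_ge1Dx (- z); lra.
rewrite -expRD subrr expR0; nra.
Qed.

(** With [e = e^(z/2)], the square splits into [(e - 1)^2 (e + 1)^2]. The bound [1 + z/2 <= e] puts
    the first factor below the convexity gap, and the second is at most [2 (e^2 + 1)]. *)
Lemma sqr_dist_le_breg x x0 : 0 < x -> 0 < x0 ->
  (x - x0) ^+ 2 <= 2 * (x + x0) * breg x x0.
Proof.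
move=> x_gt0 x0_gt0; have [z xE ->] := bregE x x0 x_gt0 x0_gt0.
have eE : expR z = expR (z / 2) * expR (z / 2) by rewrite -expRD; congr expR; lra.
have := expR_ge1Dx (z / 2); have := expR_gt0 (z / 2); move: eE xE.
set e := expR (z / 2) => -> -> e_gt0 e_ge.
rewrite (_ : (_ - _) ^+ 2 = x0 ^+ 2 * ((e - 1) ^+ 2 * (e + 1) ^+ 2)); last by ring.
rewrite (_ : 2 * _ * _ = x0 ^+ 2 * (2 * (e * e + 1) * (e * e - 1 - z))); last by ring.
rewrite ler_pM2l ?exprn_gt0//.
apply: (@le_trans _ _ (2 * (e * e + 1) * (e - 1) ^+ 2)).
  by rewrite [leLHS]mulrC; apply: ler_wpM2r; [exact: sqr_ge0 | have := sqr_ge0 (e - 1); nra].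
by apply: ler_wpM2l; nra.
Qed.

(** Linear growth at infinity: writing [ln y = ln (y/2) + ln 2] halves the slope of the tangent
    bound, so the logarithm absorbs only half of [x]. *)
Lemma le_breg x x0 : 0 < x -> 0 < x0 -> x <= 2 * (breg x x0 + x0).
Proof.
move=> x_gt0 x0_gt0; rewrite /breg.
have h : ln (x / x0) <= x / x0 / 2 - 1 + 1.
  have -> : ln (x / x0) = ln (x / x0 / 2) + ln 2.
    by rewrite -lnM ?posrE ?divr_gt0// divfK.
  apply: lerD.
    have h0 : 0 < x / x0 / 2 by rewrite !divr_gt0.
    by have := @le_ln1Dx R (x / x0 / 2 - 1); rewrite (_ : 1 + _ = x / x0 / 2); [apply|]; lra.
  by have := @le_ln1Dx R 1; rewrite (_ : 1 + 1 = 2)//; apply; lra.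
have {h} : x0 * ln (x / x0) <= x / 2.
  apply: le_trans (ler_wpM2l (ltW x0_gt0) h) _.
  by rewrite subrK mulrA mulrCA divff ?gt_eqF// mulr1.
lra.
Qed.

(** Discarding the positive [e^z] in [e^z - 1 - z <= c / x0] bounds [z] from below: sublevel sets
    stay away from 0. *)
Lemma breg_ge x x0 c : 0 < x -> 0 < x0 -> breg x x0 <= c ->
  x0 * expR (- (c / x0 + 1)) <= x.
Proof.
move=> x_gt0 x0_gt0; have [z -> ->] := bregE x x0 x_gt0 x0_gt0 => hc.
rewrite ler_pM2l// ler_expR.
have : expR z - 1 - z <= c / x0 by rewrite ler_pdivlMr// mulrC.
by have := expR_gt0 z; lra.
Qed.

(** The right side is the square of [e^(x/2) - e^(-x/2)], which is at least [x/2] for [x >= 0]; the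
    claim is even in [x]. *)
Lemma sqr_le_expRD x : x ^+ 2 / 4 <= expR x + expR (- x) - 2.
Proof.
wlog x_ge0 : x / 0 <= x => [hw|].
  have [/hw//|/ltW x_le0] := leP 0 x.
  have := hw (- x); rewrite opprK sqrrN oppr_ge0 => /(_ x_le0); lra.
have eE : expR x = expR (x / 2) * expR (x / 2) by rewrite -expRD; congr expR; lra.
have eN : expR (x / 2) * expR (- (x / 2)) = 1 by rewrite -expRD subrr expR0.
have eE' : expR (- x) = expR (- (x / 2)) * expR (- (x / 2)).
  by rewrite -expRD; congr expR; lra.
have := expR_ge1Dx (x / 2); have : expR (- (x / 2)) <= 1.
  by rewrite -[leRHS]expR0 ler_expR; lra.
have := expR_gt0 (- (x / 2)); rewrite eE eE'.
move: eN; set e := expR (x / 2); set f := expR (- (x / 2)) => ef f_gt0 f_le1 e_ge.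
have -> : e * e + f * f - 2 = (e - f) ^+ 2 by ring: ef.
have -> : x ^+ 2 / 4 = (x / 2) ^+ 2 by field.
by rewrite ler_sqr ?nnegrE; lra.
Qed.

(** A mean value bound for [y -> x e^(-y)]: the slope is at most the larger of the two endpoint
    values, and the sign of [y] tells which one that is. *)
Lemma dist_expRN_le x y B : 0 <= x -> x <= B -> x * expR (- y) <= B ->
  `|x - x * expR (- y)| <= B * `|y|.
Proof.
move=> x_ge0 xB eB; have e_gt0 := expR_gt0 (- y).
have B_ge0 : 0 <= B := le_trans x_ge0 xB.
have [y_ge0|y_lt0] := leP 0 y.
  have e_le1 : expR (- y) <= 1 by rewrite -expR0 ler_expR; lra.
  rewrite (ger0_norm y_ge0) ger0_norm; last by nra.
  apply: (@le_trans _ _ (x * y)); last by apply: ler_wpM2r.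
  rewrite -[X in X - _]mulr1 -mulrBr; apply: ler_wpM2l => //.
  by have := expR_ge1Dx (- y); lra.
have e_ge1 : 1 <= expR (- y) by rewrite -expR0 ler_expR; lra.
rewrite (ltr0_norm y_lt0) ler0_norm; last by nra.
apply: (@le_trans _ _ (x * expR (- y) * (- y))); last by apply: ler_wpM2r; lra.
have -> : - (x - x * expR (- y)) = x * expR (- y) * (1 - expR y).
  by rewrite mulrBr mulr1 -mulrA -expRD addNr expR0; ring.
apply: ler_wpM2l; first by rewrite mulr_ge0// ltW.
by have := expR_ge1Dx y; lra.
Qed.

End ScalarInequalities.

(** * Sums over finite types: Cauchy-Schwarz and uniform bounds *)

Lemma sqr_sum_le {R : realType} {I : finType} (x : I -> R) :
  (\sum_i x i) ^+ 2 <= #|I|%:R * \sum_i x i ^+ 2.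
Proof.
have -> : #|I|%:R * \sum_i x i ^+ 2 =
    \sum_(i : I) \sum_(j : I) (x i ^+ 2 / 2 + x j ^+ 2 / 2).
  under [RHS]eq_bigr do rewrite big_split/= sumr_const -mulr_suml.
  rewrite big_split/= sumr_const sumrMnl -mulr_suml -mulrnDl -splitr.
  by rewrite mulr_natl.
rewrite expr2 mulr_suml; apply: ler_sum => i _.
rewrite mulr_sumr; apply: ler_sum => j _.
by have := sqr_ge0 (x i - x j); lra.
Qed.

Section FiniteSums.
Context {R : realType} {I J : finType}.

Lemma ler_sum2 (f g : I -> J -> R) : (forall i j, f i j <= g i j) ->
  \sum_i \sum_j f i j <= \sum_i \sum_j g i j.
Proof. by move=> fg; apply: ler_sum => i _; apply: ler_sum => j _. Qed.

Lemma sumr_ge0_2 (f : I -> J -> R) : (forall i j, 0 <= f i j) ->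
  0 <= \sum_i \sum_j f i j.
Proof. by move=> f0; apply: sumr_ge0 => i _; apply: sumr_ge0 => j _. Qed.

Lemma ler_sum_term (f : I -> R) i : (forall i, 0 <= f i) -> f i <= \sum_i f i.
Proof. by move=> f0; rewrite (bigD1 i)//= lerDl sumr_ge0. Qed.

Lemma ler_sum2_term (f : I -> J -> R) i j : (forall i j, 0 <= f i j) ->
  f i j <= \sum_i \sum_j f i j.
Proof.
move=> f0; rewrite (bigD1 i)//= (bigD1 j)//= -addrA lerDl addr_ge0 ?sumr_ge0//.
by move=> k _; apply: sumr_ge0.
Qed.

Lemma mulr_sumr2 (c : R) (f : I -> J -> R) :
  \sum_i \sum_j c * f i j = c * \sum_i \sum_j f i j.
Proof. by rewrite mulr_sumr; apply: eq_bigr => i _; rewrite mulr_sumr. Qed.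

Lemma sumrD2 (f g : I -> J -> R) :
  \sum_i \sum_j (f i j + g i j) = \sum_i \sum_j f i j + \sum_i \sum_j g i j.
Proof. by rewrite -big_split; apply: eq_bigr => i _; rewrite big_split. Qed.

Lemma fin_lower_bound (f : I -> J -> R) : (forall i j, 0 < f i j) ->
  exists2 m, 0 < m & forall i j, m <= f i j.
Proof.
(* The sum of the inverses dominates each of them; the [+ 1] keeps the witness positive when an
   index type is empty, as [0^-1 = 0]. *)
move=> f0; exists (\sum_i \sum_j (f i j)^-1 + 1)^-1 => [|i j].
  by rewrite invr_gt0 ltr_wpDl// sumr_ge0_2// => i j; rewrite invr_ge0 ltW.
rewrite -[leRHS]invrK lef_pV2 ?posrE ?invr_gt0//.
  rewrite (@le_trans _ _ (\sum_i \sum_j (f i j)^-1)) ?lerDl//.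
  by apply: (ler_sum2_term (fun i j => (f i j)^-1)) => k l; rewrite invr_ge0 ltW.
by rewrite ltr_wpDl// sumr_ge0_2// => k l; rewrite invr_ge0 ltW.
Qed.

Lemma fin_upper_bound (f : I -> J -> R) :
  exists2 B, 0 < B & forall i j, `|f i j| <= B.
Proof.
exists (\sum_i \sum_j `|f i j| + 1) => [|i j].
  by rewrite ltr_wpDl// sumr_ge0_2.
rewrite (@le_trans _ _ (\sum_i \sum_j `|f i j|)) ?lerDl//.
exact: (ler_sum2_term (fun i j => `|f i j|)).
Qed.

Lemma sum_const2 (x : R) : \sum_(i : I) \sum_(j : J) x = (#|I| * #|J|)%:R * x.
Proof.
under eq_bigr do rewrite sumr_const.
by rewrite sumr_const -mulrnA mulr_natl mulnC.
Qed.

Lemma sqr_sum_le2 (x : I -> J -> R) :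
  (\sum_i \sum_j x i j) ^+ 2 <= (#|I| * #|J|)%:R * \sum_i \sum_j x i j ^+ 2.
Proof.
apply: le_trans (sqr_sum_le _) _; rewrite natrM -mulrA ler_wpM2l//.
by rewrite mulr_sumr; apply: ler_sum => i _; exact: sqr_sum_le.
Qed.

Lemma sum_sqr_le_sqr_sum (x : I -> J -> R) :
  \sum_i \sum_j x i j ^+ 2 <= (\sum_i \sum_j `|x i j|) ^+ 2.
Proof.
rewrite expr2 -mulr_sumr2; apply: ler_sum2 => i j.
rewrite -(real_normK (num_real (x i j))) expr2; apply: ler_wpM2r => //.
exact: (ler_sum2_term (fun i j => `|x i j|)).
Qed.

End FiniteSums.

(** * Policies, their log-ratios and Gibbs' inequality *)

Section Policies.
Context {R : realType} {S A : finType}.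
Implicit Types u us : S -> A -> R.

Definition lratio u us s a : R :=
  ln (u s a / utilde u s) - ln (us s a / utilde us s).

Lemma utilde_gt0 u s (a : A) : posu u -> 0 < utilde u s.
Proof.
move=> u0; rewrite /utilde (bigD1 a)//= ltr_wpDr//.
by apply: sumr_ge0 => b _; exact: ltW.
Qed.

Lemma le_utilde u s a : posu u -> u s a <= utilde u s.
Proof. by move=> u0; apply: ler_sum_term => b; exact: ltW. Qed.

Lemma sum_policy us s (a : A) : posu us -> \sum_b us s b / utilde us s = 1.
Proof.
by move=> us0; rewrite -mulr_suml divff// gt_eqF// (utilde_gt0 _ _ a).
Qed.

(* Equality fails only when [A] is empty. *)
Lemma sum_policy_le1 us s : posu us -> \sum_(a : A) us s a / utilde us s <= 1.
Proof.
move=> us0; have [a0 _|a0] := pickP (fun _ : A => true).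
  by rewrite (sum_policy _ _ a0).
by rewrite big_pred0 => // a; move: (a0 a).
Qed.

Lemma policy_le1 us s a : posu us -> us s a / utilde us s <= 1.
Proof.
by move=> us0; rewrite ler_pdivrMr ?mul1r ?le_utilde// (utilde_gt0 _ _ a).
Qed.

Lemma sum_mul_policy u us s : posu us ->
  \sum_a utilde u s * (us s a / utilde us s) = \sum_(a : A) u s a.
Proof.
move=> us0; have [a0 _|a0] := pickP (fun _ : A => true).
  by rewrite -mulr_sumr (sum_policy _ _ a0)// mulr1.
by rewrite !big_pred0 => // a; move: (a0 a).
Qed.

(** Tilting by [expR (- lratio)] swaps the policy of [u] for that of [us] and keeps the state
    marginal; the sums over actions below are therefore unchanged by tilting. *)
Lemma mul_expR_lratioN u us s a : posu u -> posu us ->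
  u s a * expR (- lratio u us s a) = utilde u s * (us s a / utilde us s).
Proof.
move=> u0 us0; have ut0 := utilde_gt0 _ s a u0; have ust0 := utilde_gt0 _ s a us0.
rewrite /lratio opprB expRD expRN !lnK ?posrE ?divr_gt0//.
by field; rewrite !gt_eqF.
Qed.

Lemma mul_expR_lratio u us s a : posu u -> posu us ->
  us s a * expR (lratio u us s a) = utilde us s * (u s a / utilde u s).
Proof.
move=> u0 us0; rewrite -mul_expR_lratioN//; congr (_ * expR _).
by rewrite /lratio opprB.
Qed.

Lemma sum_mul_expR_lratioN u us s : posu u -> posu us ->
  \sum_a u s a * expR (- lratio u us s a) = \sum_a u s a.
Proof.
move=> u0 us0; under eq_bigr do rewrite mul_expR_lratioN//.
exact: sum_mul_policy.
Qed.

Lemma sum_mul_expR_lratio u us s : posu u -> posu us ->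
  \sum_a us s a * expR (lratio u us s a) = \sum_a us s a.
Proof.
move=> u0 us0; under eq_bigr do rewrite mul_expR_lratio//.
exact: sum_mul_policy.
Qed.

(** Gibbs' inequality: [1 + y <= e^y], and tilting preserves the mass of [us]. *)
Lemma sum_mul_lratio_le0 u us s : posu u -> posu us ->
  \sum_a us s a * lratio u us s a <= 0.
Proof.
move=> u0 us0.
apply: (@le_trans _ _ (\sum_a (us s a * expR (lratio u us s a) - us s a))).
  apply: ler_sum => a _.
  rewrite -[X in _ - X]mulr1 -mulrBr ler_pM2l//.
  by have := expR_ge1Dx (lratio u us s a); lra.
by rewrite sumrB sum_mul_expR_lratio// subrr.
Qed.

(** Both sides are a symmetrized Kullback-Leibler divergence weighted by the marginals. They differ
    by the mass defects of the two tiltings, which vanish; the form on the right has nonnegative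
    terms. *)
Lemma sum_dev_mul_lratio u us s : posu u -> posu us ->
  \sum_a (u s a - us s a) * lratio u us s a =
  \sum_a (u s a * (expR (- lratio u us s a) - 1 + lratio u us s a) +
          us s a * (expR (lratio u us s a) - 1 - lratio u us s a)).
Proof.
move=> u0 us0; apply/eqP; rewrite -subr_eq0 -sumrB.
rewrite (eq_bigr (fun a => (u s a - u s a * expR (- lratio u us s a)) +
  (us s a - us s a * expR (lratio u us s a)))); last by move=> a _; ring.
rewrite big_split/= !sumrB sum_mul_expR_lratioN// sum_mul_expR_lratio//.
by rewrite !subrr addr0.
Qed.

Lemma sum_dev_mul_lratio_ge0 u us s : posu u -> posu us ->
  0 <= \sum_a (u s a - us s a) * lratio u us s a.
Proof.
move=> u0 us0; rewrite sum_dev_mul_lratio//; apply: sumr_ge0 => a _.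
apply: addr_ge0; (apply: mulr_ge0; first exact: ltW).
  by have := expR_ge1Dx (- lratio u us s a); lra.
by have := expR_ge1Dx (lratio u us s a); lra.
Qed.

(** Under a common lower bound [m] the linear parts of the two convexity gaps cancel, leaving
    [m (e^y + e^(-y) - 2)]; [sqr_le_expRD] then gives [m / 4]. *)
Lemma sum_dev_mul_lratio_ge u us m : 0 <= m -> posu u -> posu us ->
  (forall s a, m <= u s a) -> (forall s a, m <= us s a) ->
  m / 4 * (\sum_s \sum_a lratio u us s a ^+ 2) <=
  \sum_s \sum_a (u s a - us s a) * lratio u us s a.
Proof.
move=> m0 u0 us0 mu mus; rewrite -mulr_sumr2; apply: ler_sum => s _.
rewrite sum_dev_mul_lratio//; apply: ler_sum => a _.
set y := lratio u us s a.
have y1 := expR_ge1Dx y; have y2 := expR_ge1Dx (- y).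
have := sqr_le_expRD y => y3.
have h1 : m * (expR (- y) - 1 + y) <= u s a * (expR (- y) - 1 + y).
  by apply: ler_wpM2r; [lra | exact: mu].
have h2 : m * (expR y - 1 - y) <= us s a * (expR y - 1 - y).
  by apply: ler_wpM2r; [lra | exact: mus].
by have := ler_wpM2l m0 y3; nra.
Qed.

End Policies.

(** * Energy, dissipation and the cross term *)

Section Energy.
Context {R : realType} {S A : finType}.
Variables (P : S -> A -> S -> R) (gamma tau alpha : R) (us : S -> A -> R).
Hypotheses (HP0 : forall s a s', 0 <= P s a s')
  (HP1 : forall s a, \sum_(s' : S) P s a s' = 1)
  (Hg0 : 0 < gamma) (Hg1 : gamma < 1) (Htau : 0 < tau) (Halpha : 0 < alpha)
  (us0 : posu us).
Implicit Types (w : S -> R) (u d : S -> A -> R) (m U : R).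

Definition flux d s' : R := \sum_s \sum_a Kmat gamma P s a s' * d s a.
Definition cost w s a : R := \sum_s' Kmat gamma P s a s' * w s'.
Definition dev u s a : R := u s a - us s a.

Definition lyap w u : R :=
  alpha / 2 * \sum_s w s ^+ 2 + tau * \sum_s \sum_a breg (u s a) (us s a).

Definition dissip w u : R :=
  alpha * \sum_s w s ^+ 2 + tau * \sum_s \sum_a dev u s a * lratio u us s a.

Definition cross w u : R := - \sum_s w s * flux (dev u) s.

(** The time derivative of [cross] along the flow: the first two terms come from [w'], the last from
    [u'] after moving [K] onto [w]. *)
Definition cross_rate w u : R :=
  \sum_s w s * flux (dev u) s - (\sum_s flux (dev u) s ^+ 2) / alpha +
  \sum_s \sum_a cost w s a * (u s a * (lratio u us s a + cost w s a / tau)).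

Lemma Kmat_sqr_le1 s a s' : Kmat gamma P s a s' ^+ 2 <= 1.
Proof.
have P1 : P s a s' <= 1.
  by rewrite -(HP1 s a); apply: (ler_sum_term (P s a)) => t; exact: HP0.
have P0 := HP0 s a s'; rewrite /Kmat.
have gP1 : gamma * P s a s' <= 1 by rewrite mulr_ile1// ltW.
have gP0 : 0 <= gamma * P s a s' by rewrite mulr_ge0// ltW.
move: gP1 gP0; set g := gamma * _ => gP1 gP0.
by case: (s == s') => /=; nra.
Qed.

Lemma flux_sqr_le d :
  \sum_s flux d s ^+ 2 <= (#|S| * (#|S| * #|A|))%:R * \sum_s \sum_a d s a ^+ 2.
Proof.
have h s' : flux d s' ^+ 2 <= (#|S| * #|A|)%:R * \sum_s \sum_a d s a ^+ 2.
  apply: le_trans (sqr_sum_le2 _) _; apply: ler_wpM2l => //.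
  apply: ler_sum2 => s a; rewrite exprMn ler_piMl ?sqr_ge0//.
  exact: Kmat_sqr_le1.
rewrite natrM -mulrA; apply: le_trans (ler_sum _ (fun s _ => h s)) _.
by rewrite sumr_const [leRHS]mulr_natl.
Qed.

Lemma cost_sqr_le w s a : cost w s a ^+ 2 <= #|S|%:R * \sum_s w s ^+ 2.
Proof.
apply: le_trans (sqr_sum_le _) _; apply: ler_wpM2l => //.
apply: ler_sum => s' _; rewrite exprMn ler_piMl ?sqr_ge0//.
exact: Kmat_sqr_le1.
Qed.

Lemma fluxE d s' :
  flux d s' = \sum_a d s' a - gamma * \sum_s \sum_a P s a s' * d s a.
Proof.
rewrite -mulr_sumr2 /flux /Kmat.
have -> : \sum_a d s' a = \sum_s \sum_a (s == s')%:R * d s a.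
  rewrite [RHS](bigD1 s')//= [X in _ + X]big1 ?addr0 => [|s /negPf ss'].
    by apply: eq_bigr => a _; rewrite eqxx mul1r.
  by apply: big1 => a _; rewrite ss' mul0r.
rewrite -sumrB; apply: eq_bigr => s _; rewrite -sumrB.
by apply: eq_bigr => a _; ring.
Qed.

(** The flux is the marginal minus [gamma] times the mass transported by [P]. Since [P s a] sums to
    1, transport does not increase the l1 norm. *)
Lemma sum_norm_marginal_le d :
  \sum_s `|\sum_a d s a| <=
  \sum_s `|flux d s| + gamma * \sum_s \sum_a `|d s a|.
Proof.
have -> : \sum_s \sum_a `|d s a| =
    \sum_s' \sum_s \sum_a P s a s' * `|d s a|.
  rewrite [RHS]exchange_big; apply: eq_bigr => s _.
  rewrite [RHS]exchange_big; apply: eq_bigr => a _.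
  by rewrite -mulr_suml HP1 mul1r.
rewrite mulr_sumr -big_split; apply: ler_sum => s' _.
have -> : \sum_a d s' a = flux d s' + gamma * \sum_s \sum_a P s a s' * d s a.
  by rewrite fluxE subrK.
apply: le_trans (ler_normD _ _) _; rewrite lerD2l normrM (gtr0_norm Hg0).
rewrite ler_pM2l//; apply: le_trans (ler_norm_sum _ _ _) _.
apply: ler_sum => s _; apply: le_trans (ler_norm_sum _ _ _) _.
by apply: ler_sum => a _; rewrite normrM (ger0_norm (HP0 _ _ _)).
Qed.

(* The deviation splits as d = b + (sum_a d) pi_s, where b only sees the change
   of policy; the discount factor makes the flux control the marginals. *)
Lemma sum_norm_dev_le u U : posu u -> (forall s, utilde u s <= U) ->
  (1 - gamma) * \sum_s \sum_a `|dev u s a| <=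
  \sum_s `|flux (dev u) s| + U * \sum_s \sum_a `|lratio u us s a|.
Proof.
move=> u0 uU.
(* The term with factor [gamma] in [sum_norm_marginal_le] is absorbed on the left, which leaves
   [1 - gamma]. *)
suff h : \sum_s \sum_a `|dev u s a| <=
    U * \sum_s \sum_a `|lratio u us s a| + \sum_s `|\sum_a dev u s a|.
  by have := sum_norm_marginal_le (dev u); lra.
rewrite -mulr_sumr2 -big_split; apply: ler_sum => s _ /=.
apply: (@le_trans _ _ (\sum_a (U * `|lratio u us s a| +
    us s a / utilde us s * `|\sum_a dev u s a|))); last first.
  rewrite big_split/= lerD2l -mulr_suml ler_piMl//; exact: sum_policy_le1.
apply: ler_sum => a _.
have ut0 := utilde_gt0 _ s a u0; have ust0 := utilde_gt0 _ s a us0.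
have pi0 : 0 <= us s a / utilde us s by rewrite divr_ge0// ltW.
have -> : dev u s a = (u s a - u s a * expR (- lratio u us s a)) +
    us s a / utilde us s * \sum_a dev u s a.
  rewrite mul_expR_lratioN// /dev sumrB -!/(utilde _ _).
  by field; rewrite gt_eqF.
apply: le_trans (ler_normD _ _) _; rewrite [X in _ + X <= _]normrM.
rewrite (ger0_norm pi0) lerD2r; apply: dist_expRN_le; first exact: ltW.
  exact: le_trans (le_utilde _ _ _ u0) (uU s).
rewrite mul_expR_lratioN//; apply: le_trans (uU s).
by rewrite ler_piMr ?policy_le1// ltW.
Qed.

(** An l2 form of [sum_norm_dev_le], by [(p + q)^2 <= 2 p^2 + 2 q^2] and Cauchy-Schwarz; this
    produces the cardinalities. *)
Lemma sum_dev_sqr_le u U : posu u -> (forall s, utilde u s <= U) ->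
  (1 - gamma) ^+ 2 * \sum_s \sum_a dev u s a ^+ 2 <=
  2 * #|S|%:R * \sum_s flux (dev u) s ^+ 2 +
  2 * U ^+ 2 * (#|S| * #|A|)%:R * \sum_s \sum_a lratio u us s a ^+ 2.
Proof.
move=> u0 uU.
have h0 := sum_norm_dev_le u U u0 uU.
have h1 := sum_sqr_le_sqr_sum (dev u).
have h2 := sqr_sum_le (fun s => `|flux (dev u) s|).
have h3 := sqr_sum_le2 (fun s a => `|lratio u us s a|).
have e2 : \sum_s `|flux (dev u) s| ^+ 2 = \sum_s flux (dev u) s ^+ 2.
  by apply: eq_bigr => s _; rewrite real_normK ?num_real.
have e3 : \sum_s \sum_a `|lratio u us s a| ^+ 2 =
    \sum_s \sum_a lratio u us s a ^+ 2.
  by apply: eq_bigr => s _; apply: eq_bigr => a _; rewrite real_normK ?num_real.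
move: h0 h1 h2 h3; rewrite e2 e3.
have d0 : 0 <= \sum_s \sum_a `|dev u s a| by apply: sumr_ge0_2.
move: d0; set d1 := \sum_s \sum_a `|_|; set d2 := \sum_s \sum_a _ ^+ 2.
set q1 := \sum_s `|_|; set q2 := \sum_s _ ^+ 2.
set y1 := \sum_s \sum_a `|_|; set y2 := \sum_s \sum_a _ ^+ 2.
move=> d0 h0 h1 h2 h3.
apply: (@le_trans _ _ ((q1 + U * y1) ^+ 2)).
  apply: (@le_trans _ _ (((1 - gamma) * d1) ^+ 2)).
    by rewrite exprMn ler_wpM2l// sqr_ge0.
  have d3 : 0 <= (1 - gamma) * d1 by rewrite mulr_ge0// subr_ge0 ltW.
  by rewrite ler_sqr ?nnegrE// (le_trans d3).
have := ler_wpM2l (sqr_ge0 U) h3; have := sqr_ge0 (q1 - U * y1); lra.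
Qed.

Lemma sublevel_bounds M : exists m U, [/\ 0 < m, 0 < U & forall w u,
  posu u -> lyap w u <= M ->
  [/\ forall s a, m <= u s a, forall s a, m <= us s a,
      forall s, utilde u s <= U, forall s a, u s a <= U &
      forall s a, us s a <= U]].
Proof.
(* On the sublevel set each entry of [breg] is at most [M / tau], and [breg_ge] turns this into a
   lower bound on [u]. *)
have [m1 m1_gt0 m1P] := fin_lower_bound
  (fun s a => us s a * expR (- (M / tau / us s a + 1)))
  (fun s a => mulr_gt0 (us0 s a) (expR_gt0 _)).
have [m2 m2_gt0 m2P] := fin_lower_bound us us0.
have [U1 U1_gt0 U1P] := fin_upper_bound us.
(* [le_breg] summed over the actions bounds the marginals; the [unit] index is a dummy that fits the
   two-index lemma. *)
have [U2 U2_gt0 U2P] := fin_upper_bound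
  (fun s (_ : unit) => \sum_(a : A) 2 * (M / tau + us s a)).
exists (Num.min m1 m2), (U1 + U2); split; [by rewrite lt_min m1_gt0 | lra |].
move=> w u u0 Lw.
have b0 s a : 0 <= breg (u s a) (us s a) by apply: breg_ge0.
have bM s a : breg (u s a) (us s a) <= M / tau.
  rewrite ler_pdivlMr// mulrC; apply: le_trans Lw; rewrite /lyap.
  apply: (@le_trans _ _ (tau * \sum_s \sum_a breg (u s a) (us s a))).
    rewrite ler_pM2l//.
    exact: (ler_sum2_term (fun s a => breg (u s a) (us s a))).
  rewrite lerDr; apply: mulr_ge0; first by rewrite divr_ge0// ltW.
  by apply: sumr_ge0 => i _; exact: sqr_ge0.
have utU s : utilde u s <= U2.
  apply: le_trans (U2P s tt); apply: le_trans (ler_norm _).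
  apply: ler_sum => a _; apply: le_trans (le_breg _ _ (u0 s a) (us0 s a)) _.
  by rewrite ler_pM2l// lerD2r.
have utle s a := le_trans (le_utilde u s a u0) (utU s).
split=> s.
- move=> a; rewrite ge_min (le_trans (m1P s a))//.
  exact: breg_ge.
- by move=> a; rewrite ge_min m2P orbT.
- by have := utU s; lra.
- by move=> a; have := utle s a; lra.
- by move=> a; have := U1P s a; rewrite gtr0_norm//; lra.
Qed.

Lemma sum_sqr_ge0 w : 0 <= \sum_s w s ^+ 2.
Proof. by apply: sumr_ge0 => s _; exact: sqr_ge0. Qed.

Lemma sum_breg_ge0 u : posu u -> 0 <= \sum_s \sum_a breg (u s a) (us s a).
Proof. by move=> u0; apply: sumr_ge0_2 => s a; exact: breg_ge0. Qed.

Lemma sum_sqr_le_lyap w u : posu u -> alpha * \sum_s w s ^+ 2 <= 2 * lyap w u.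
Proof. by move=> /sum_breg_ge0 /(mulr_ge0 (ltW Htau)) b0; rewrite /lyap; lra. Qed.

Lemma sum_breg_le_lyap w u :
  tau * \sum_s \sum_a breg (u s a) (us s a) <= lyap w u.
Proof.
rewrite /lyap lerDr mulr_ge0 ?sum_sqr_ge0//.
by rewrite divr_ge0// ltW.
Qed.

Lemma lyap_ge0 w u : posu u -> 0 <= lyap w u.
Proof.
move=> u0; apply: le_trans (sum_breg_le_lyap w u).
by rewrite mulr_ge0 ?sum_breg_ge0// ltW.
Qed.

Lemma breg_le_lyap w u s a : posu u -> breg (u s a) (us s a) <= lyap w u / tau.
Proof.
move=> u0; rewrite ler_pdivlMr// mulrC; apply: le_trans (sum_breg_le_lyap w u).
rewrite ler_pM2l//; apply: (ler_sum2_term (fun s a => breg (u s a) (us s a))).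
by move=> t b; exact: breg_ge0.
Qed.

Lemma dissip_ge0 w u : posu u -> 0 <= dissip w u.
Proof.
move=> u0; apply: addr_ge0; (apply: mulr_ge0; first exact: ltW).
  exact: sum_sqr_ge0.
by apply: sumr_ge0 => s _; exact: sum_dev_mul_lratio_ge0.
Qed.

Lemma sum_dev_sqr_le_lyap w u U : 0 <= U -> posu u -> (forall s a, u s a <= U) ->
  (forall s a, us s a <= U) ->
  tau * \sum_s \sum_a dev u s a ^+ 2 <= 4 * U * lyap w u.
Proof.
move=> U0 u0 uU usU.
have h := sum_breg_le_lyap w u.
apply: (@le_trans _ _ (4 * U * (tau * \sum_s \sum_a breg (u s a) (us s a)))).
  rewrite mulrCA ler_pM2l// -mulr_sumr2; apply: ler_sum2 => s a.
  apply: le_trans (sqr_dist_le_breg _ _ (u0 s a) (us0 s a)) _.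
  apply: ler_wpM2r; first exact: breg_ge0.
  by have := uU s a; have := usU s a; lra.
by apply: ler_wpM2l => //; lra.
Qed.

Lemma lyap_le w u m : 0 < m -> posu u -> (forall s a, m <= u s a) ->
  lyap w u <=
  alpha / 2 * \sum_s w s ^+ 2 + tau / m * \sum_s \sum_a dev u s a ^+ 2.
Proof.
move=> m0 u0 mu; rewrite /lyap lerD2l -mulrA ler_pM2l// -mulr_sumr2.
by apply: ler_sum2 => s a; rewrite mulrC; exact: breg_le.
Qed.

Lemma norm_cross_le w u :
  `|cross w u| <= (\sum_s w s ^+ 2 + \sum_s flux (dev u) s ^+ 2) / 2.
Proof.
rewrite /cross normrN; apply: le_trans (ler_norm_sum _ _ _) _.
rewrite -big_split mulr_suml; apply: ler_sum => s _ /=; rewrite ler_norml.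
have := sqr_ge0 (w s - flux (dev u) s); have := sqr_ge0 (w s + flux (dev u) s).
by move=> h1 h2; apply/andP; split; lra.
Qed.

(** Young's inequality with weight [alpha] spends half of [- |q|^2 / alpha] on [<w, q>], and the
    other half survives. The last sum is controlled by [u <= U] and [c y <= c^2 + y^2]. *)
Lemma cross_rate_le w u U : 0 <= U -> posu u -> (forall s a, u s a <= U) ->
  cross_rate w u <=
  - ((\sum_s flux (dev u) s ^+ 2) / (2 * alpha)) +
  (alpha / 2 + U * (1 + tau^-1) * (#|S| * #|A| * #|S|)%:R) * \sum_s w s ^+ 2 +
  U * \sum_s \sum_a lratio u us s a ^+ 2.
Proof.
move=> U0 u0 uU; set q := flux (dev u).
have h1 : \sum_s w s * q s <=
    alpha / 2 * \sum_s w s ^+ 2 + (\sum_s q s ^+ 2) / (2 * alpha).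
  rewrite mulr_sumr mulr_suml -big_split; apply: ler_sum => s _ /=.
  rewrite -subr_ge0 (_ : _ - _ = (alpha * w s - q s) ^+ 2 / (2 * alpha)).
    by rewrite divr_ge0 ?sqr_ge0// mulr_ge0// ltW.
  by field; rewrite gt_eqF.
have it0 : 0 <= tau^-1 by rewrite invr_ge0 ltW.
have h2 s a : cost w s a * (u s a * (lratio u us s a + cost w s a / tau)) <=
    U * (1 + tau^-1) * (#|S|%:R * \sum_s w s ^+ 2) + U * lratio u us s a ^+ 2.
  have := cost_sqr_le w s a; set c := cost w s a; set y := lratio u us s a.
  set W := #|S|%:R * _ => cW.
  have c0 := sqr_ge0 c; have y0 := sqr_ge0 y.
  (* The left side may be negative, so it is replaced by a nonnegative majorant before [u] is
     replaced by [U]. *)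
  have cy : c * y + c ^+ 2 / tau <= (1 + tau^-1) * c ^+ 2 + y ^+ 2.
    by have := sqr_ge0 (c - y); rewrite mulrDl [c ^+ 2 / tau]mulrC; lra.
  have r0 : 0 <= (1 + tau^-1) * c ^+ 2 + y ^+ 2.
    by rewrite addr_ge0// mulr_ge0// addr_ge0.
  rewrite (_ : c * _ = u s a * (c * y + c ^+ 2 / tau)); last by ring.
  apply: (@le_trans _ _ (u s a * ((1 + tau^-1) * c ^+ 2 + y ^+ 2))).
    by rewrite ler_pM2l.
  apply: (@le_trans _ _ (U * ((1 + tau^-1) * c ^+ 2 + y ^+ 2))).
    by apply: ler_wpM2r.
  rewrite mulrDr lerD2r mulrA; apply: ler_wpM2l => //.
  by rewrite mulr_ge0// addr_ge0.
have := ler_sum2 _ _ h2; rewrite sumrD2 mulr_sumr2 [X in _ <= _ + X]mulr_sumr2.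
rewrite (_ : \sum_(s : S) \sum_(a : A) (#|S|%:R * \sum_s w s ^+ 2) =
  (#|S| * #|A| * #|S|)%:R * \sum_s w s ^+ 2); last first.
  under eq_bigr do rewrite sumr_const.
  by rewrite sumr_const -mulrnA -[LHS]mulr_natl mulrA -natrM [(#|A| * #|S|)%N]mulnC.
have hq : (\sum_s q s ^+ 2) / alpha =
    (\sum_s q s ^+ 2) / (2 * alpha) + (\sum_s q s ^+ 2) / (2 * alpha).
  by field; rewrite gt_eqF.
rewrite /cross_rate -/q hq.
rewrite [(alpha / 2 + _) * _]mulrDl -[_ * (1 + _) * _ * _]mulrA.
move: h1; set Q := (\sum_s q s ^+ 2) / (2 * alpha); set W := \sum_s w s ^+ 2.
set Y := \sum_s \sum_a lratio u us s a ^+ 2; set N := _%:R * W.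
set k := U * (1 + _) => h1 h3.

lra.
Qed.

(** The algebra of the modified energy, where [W], [Y], [Q] stand for [|w|^2], [|y|^2], [|q|^2], and
    [D], [X], [Xr] for dissipation, cross term and its rate. *)
Lemma modified_energy_constants (mu C5 C6 C7 : R) :
  0 < mu -> 0 < C5 -> 0 < C6 -> 0 < C7 ->
  exists eps c, [/\ 0 < eps, 0 < c & forall W Y Q L D X Xr : R,
    [/\ 0 <= W, 0 <= Y & 0 <= Q] ->
    mu * (W + Y) <= D -> `|X| <= C5 * L ->
    Xr <= - (Q / (2 * alpha)) + C6 * (W + Y) -> L <= C7 * (W + Y + Q) ->
    `|eps * X| <= L / 2 /\ c * L <= D - eps * Xr].
Proof.
move=> mu0 C50 C60 C70.
(* The first bound keeps [eps * X] below [L / 2]; the second lets the error [C6 (W + Y)] consume at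
   most half of the dissipation. *)
pose eps := Num.min (2 * C5)^-1 (mu / (2 * C6)).
have eps0 : 0 < eps by rewrite lt_min invr_gt0 divr_gt0 ?mulr_gt0.
have e1 : eps * (2 * C5) <= 1.
  by rewrite -ler_pdivlMr ?mulr_gt0// div1r /eps ge_min lexx.
have e2 : eps * (2 * C6) <= mu.
  by rewrite -ler_pdivlMr ?mulr_gt0// /eps ge_min lexx orbT.
(* What remains: half of [mu] on [W + Y], and the gain of the cross term on [Q]. *)
pose k := Num.min (mu / 2) (eps / (2 * alpha)).
have k0 : 0 < k by rewrite lt_min !divr_gt0 ?mulr_gt0.
have k1 : k <= mu / 2 by rewrite /k ge_min lexx.
have k2 : k <= eps / (2 * alpha) by rewrite /k ge_min lexx orbT.
exists eps, (k / C7); split=> [//||W Y Q L D X Xr [W0 Y0 Q0] hD hX hXr hL].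
  by rewrite divr_gt0.
split.
  rewrite normrM gtr0_norm//.
  apply: (@le_trans _ _ (eps * (C5 * L))); first by rewrite ler_pM2l.
  have L0 : 0 <= L by rewrite -(pmulr_rge0 _ C50); apply: le_trans hX.
  by have := ler_wpM2r L0 e1; lra.
have WY0 : 0 <= W + Y by rewrite addr_ge0.
apply: (@le_trans _ _ (k * (W + Y + Q))).
  rewrite -mulrA ler_pM2l// mulrC ler_pdivrMr//; lra.
have h1 : k * (W + Y) <= mu / 2 * (W + Y) by apply: ler_wpM2r.
have h2 : k * Q <= eps / (2 * alpha) * Q by apply: ler_wpM2r.
have h3 : eps * (2 * C6) * (W + Y) <= mu * (W + Y) by apply: ler_wpM2r.
have h4 : eps * Xr <= eps * (- (Q / (2 * alpha)) + C6 * (W + Y)) by rewrite ler_pM2l.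
have h5 : eps / (2 * alpha) * Q = eps * (Q / (2 * alpha)) by ring.
by move: h2; rewrite h5; move: h4; set Qa := Q / (2 * alpha); lra.
Qed.

Lemma hypocoercivity (M : R) : exists eps c, [/\ 0 < eps, 0 < c & forall w u,
  posu u -> lyap w u <= M ->
  `|eps * cross w u| <= lyap w u / 2 /\
  c * lyap w u <= dissip w u - eps * cross_rate w u].
Proof.
have [m [U [m0 U0 mUP]]] := sublevel_bounds M.
have it0 : 0 < tau^-1 by rewrite invr_gt0.
have ia0 : 0 < alpha^-1 by rewrite invr_gt0.
pose N1 : R := (#|S| * (#|S| * #|A|))%:R.
pose N2 : R := (#|S| * #|A| * #|S|)%:R.
(* The sum of both coefficients in [sum_dev_sqr_le], so that one constant multiplies [Y + Q]. *)
pose N3 : R := 2 * #|S|%:R + 2 * U ^+ 2 * (#|S| * #|A|)%:R.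
have N10 : 0 <= N1 by [].
have N20 : 0 <= N2 by [].
have N30 : 0 <= N3 by rewrite /N3; nonneg.
have g0 : 0 < (1 - gamma) ^+ 2 by rewrite exprn_gt0// subr_gt0.
(* Four constants follow: coercivity of [dissip], size of [cross] relative to [lyap], error in
   [cross_rate], and [lyap] relative to [W + Y + Q]. *)
have mu0 : 0 < Num.min alpha (tau * (m / 4)).
  by rewrite lt_min Halpha mulr_gt0 ?divr_gt0.
have C50 : 0 < alpha^-1 + 2 * N1 * U / tau.
  by apply: ltr_wpDr => //; nonneg.
have C60 : 0 < alpha / 2 + U * (1 + tau^-1) * N2 + U.
  by apply: ltr_wpDl => //; nonneg.
have C70 : 0 < alpha / 2 + tau / m * (N3 / (1 - gamma) ^+ 2).
  by apply: ltr_wpDr; [nonneg | rewrite divr_gt0].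
have [eps [c [eps0 c0 H]]] := modified_energy_constants _ _ _ _ mu0 C50 C60 C70.
exists eps, c; split=> // w u u0 LM.
have [mu mus utU uU usU] := mUP w u u0 LM.
have W0 := sum_sqr_ge0 w; have Q0 := sum_sqr_ge0 (flux (dev u)).
have Y0 : 0 <= \sum_s \sum_a lratio u us s a ^+ 2.
  by apply: sumr_ge0_2 => s a; exact: sqr_ge0.
have Dd0 : 0 <= \sum_s \sum_a dev u s a ^+ 2.
  by apply: sumr_ge0_2 => s a; exact: sqr_ge0.
have L0 := lyap_ge0 w u u0.
apply: H; first (split; [exact: W0 | exact: Y0 | exact: Q0]).
- have := sum_dev_mul_lratio_ge u us m (ltW m0) u0 us0 mu mus.
  move/(ler_wpM2l (ltW Htau)) => h; rewrite mulrDr; apply: lerD.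
    by apply: ler_wpM2r => //; rewrite ge_min lexx.
  by apply: le_trans h; rewrite [leRHS]mulrA; apply: ler_wpM2r => //; rewrite ge_min lexx orbT.
- apply: le_trans (norm_cross_le w u) _.
  have h1 : \sum_s w s ^+ 2 <= 2 * lyap w u / alpha.
    by rewrite ler_pdivlMr// mulrC; exact: sum_sqr_le_lyap.
  have h2 : \sum_s \sum_a dev u s a ^+ 2 <= 4 * U * lyap w u / tau.
    rewrite ler_pdivlMr// mulrC; apply: sum_dev_sqr_le_lyap => //; exact: ltW.
  have := ler_wpM2l N10 h2; have := flux_sqr_le (dev u); rewrite -/N1; lra.
- have := cross_rate_le w u U (ltW U0) u0 uU; rewrite -/N2.
  set W := \sum_s w s ^+ 2; set Y := \sum_s \sum_a lratio u us s a ^+ 2.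
  set Qa := _ / (2 * alpha).
  have : 0 <= U * W by rewrite mulr_ge0// ltW.
  have : 0 <= (alpha / 2 + U * (1 + tau^-1) * N2) * Y.
    by nonneg.
  set k := alpha / 2 + _; lra.
- apply: le_trans (lyap_le w u m m0 u0 mu) _.
  have := sum_dev_sqr_le u U u0 utU.
  set W := \sum_s w s ^+ 2; set Y := \sum_s \sum_a lratio u us s a ^+ 2.
  set Q := \sum_s flux (dev u) s ^+ 2; set Dd := \sum_s \sum_a dev u s a ^+ 2.
  move=> h.
  have h1 : Dd <= N3 / (1 - gamma) ^+ 2 * (Y + Q).
    rewrite -mulrAC ler_pdivlMr// mulrC; apply: le_trans h _.
    have : 0 <= 2 * #|S|%:R * Y by nonneg.
    have : 0 <= 2 * U ^+ 2 * (#|S| * #|A|)%:R * Q by nonneg.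
    by rewrite /N3; lra.
  have tm0 : 0 <= tau / m by rewrite divr_ge0// ltW.
  have h2 := ler_wpM2l tm0 h1.
  have h3 : 0 <= alpha / 2 * (Y + Q) by nonneg.
  have h4 : 0 <= tau / m * (N3 / (1 - gamma) ^+ 2) * W.
    by nonneg.
  move: h2 h4; set k1 := tau / m; set k2 := N3 / _; lra.
Qed.

(** The only part unbounded as [u s a] tends to 0 is [- us * ln u], which [breg] contains.
    Log-policies are nonpositive and [ln (utilde u s)] is at most [utilde u s], so the rest is
    linear in the marginal. *)
Lemma dev_mul_lratio_le u s a B : posu u ->
  `|ln (us s a / utilde us s)| <= B -> us s a <= B ->
  `|us s a - us s a * ln (us s a)| <= B ->
  dev u s a * lratio u us s a <=
  2 * B * utilde u s + breg (u s a) (us s a) + B.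
Proof.
move=> u0 hB1 hB2 hB3.
have ut0 := utilde_gt0 _ s a u0; have ust0 := utilde_gt0 _ s a us0.
have u0' := u0 s a; have us0' := us0 s a.
have B0 : 0 <= B by lra.
have p1 : ln (u s a / utilde u s) <= 0 by apply: ln_le0; exact: policy_le1.
have p2 : ln (us s a / utilde us s) <= 0 by apply: ln_le0; exact: policy_le1.
have hB1' : - ln (us s a / utilde us s) <= B.
  by apply: le_trans hB1; rewrite -normrN ler_norm.
have hB3' := le_trans (ler_norm _) hB3.
have k1 : u s a * lratio u us s a <= u s a * B.
  by rewrite ler_pM2l// /lratio; lra.
have k2 : - (us s a * lratio u us s a) <=
    us s a * utilde u s - us s a * ln (u s a).
  rewrite -mulrBr -mulrN ler_pM2l// /lratio [ln (u s a / _)]ln_div ?posrE//.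
  by have := ln_sublinear ut0; lra.
have k3 : us s a * utilde u s <= B * utilde u s by rewrite ler_pM2r.
have k4 : u s a * B <= utilde u s * B by apply: ler_wpM2r => //; exact: le_utilde.
rewrite /breg ln_div ?posrE// /dev; lra.
Qed.

(** This growth bound must hold outside every fixed sublevel set, since it serves before a
    trajectory is known to be bounded. [le_breg] makes the marginals linear in [lyap]. *)
Lemma dissip_le_lyap :
  exists2 C : R, 0 < C & forall w u, posu u -> dissip w u <= C * (1 + lyap w u).
Proof.
have [B1 B10 hB1] := fin_upper_bound (fun s a => ln (us s a / utilde us s)).
have [B2 B20 hB2] := fin_upper_bound us.
have [B3 B30 hB3] := fin_upper_bound (fun s a => us s a - us s a * ln (us s a)).
pose B := B1 + B2 + B3; have B0 : 0 < B by rewrite /B; lra.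
pose n : R := (#|S| * #|A|)%:R; have n0 : 0 <= n by [].
pose k : R := #|A|%:R; have k0 : 0 <= k by [].
exists (2 + n * (4 * B * k * (1 + tau * B) + 1 + tau * B)).
  by apply: ltr_wpDr => //; nonneg.
move=> w u u0; have L0 := lyap_ge0 w u u0.
have h1 := sum_sqr_le_lyap w u u0.
have hut s : utilde u s <= k * (2 * (lyap w u / tau + B)).
  apply: (@le_trans _ _ (\sum_(a : A) 2 * (lyap w u / tau + B))).
    apply: ler_sum => a _; apply: le_trans (le_breg _ _ (u0 s a) (us0 s a)) _.
    rewrite ler_pM2l//; apply: lerD; first exact: breg_le_lyap.
    by have := le_trans (ler_norm _) (hB2 s a); rewrite /B; lra.
  by rewrite sumr_const [leRHS]mulr_natl.
have h2 s a : dev u s a * lratio u us s a <=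
    2 * B * (k * (2 * (lyap w u / tau + B))) + lyap w u / tau + B.
  apply: le_trans (dev_mul_lratio_le u s a B u0 _ _ _) _.
  - by apply: le_trans (hB1 s a) _; rewrite /B; lra.
  - by have := le_trans (ler_norm _) (hB2 s a); rewrite /B; lra.
  - by apply: le_trans (hB3 s a) _; rewrite /B; lra.
  rewrite lerD2r lerD ?breg_le_lyap//; apply: ler_wpM2l => //.
  by nonneg.
have := ler_sum2 _ _ h2; rewrite sum_const2 -(ler_pM2l Htau) -/n => h3.
rewrite /dissip; apply: le_trans (lerD h1 h3) _.
rewrite [X in _ + X <= _](_ : _ = n * (4 * B * k * (lyap w u + tau * B) + lyap w u + tau * B));
  last by field; rewrite gt_eqF.
set L := lyap w u.
have tB0 : 0 <= tau * B by rewrite mulr_ge0// ltW.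
have Bk0 : 0 <= 4 * B * k by nonneg.
have a1 : 0 <= tau * B * L by rewrite mulr_ge0.
have a2 : L + tau * B <= (1 + tau * B) * (1 + L) by lra.
have a3 := ler_wpM2l Bk0 a2.
have a4 : 4 * B * k * (L + tau * B) + L + tau * B <=
  (4 * B * k * (1 + tau * B) + 1 + tau * B) * (1 + L) by lra.
have a5 := ler_wpM2l n0 a4; lra.
Qed.

End Energy.

(** * First order conditions at the saddle point *)

Section SaddlePoint.
Context {R : realType} {S A : finType}.
Variables (P : S -> A -> S -> R) (r : S -> A -> R) (gamma tau alpha : R).
Variables (vs : S -> R) (us : S -> A -> R).
Hypotheses (Htau : 0 < tau) (Halpha : 0 < alpha)
  (Hsaddle : is_saddle alpha tau gamma P r vs us).

Lemma sum_mul_cost (d : S -> A -> R) w :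
  \sum_s \sum_a d s a * cost P gamma w s a = \sum_s w s * flux P gamma d s.
Proof.
under eq_bigr do under eq_bigr do rewrite /cost mulr_sumr.
under eq_bigr do rewrite exchange_big.
rewrite exchange_big; apply: eq_bigr => s' _; rewrite /flux -mulr_sumr2.
by apply: eq_bigr => s _; apply: eq_bigr => a _; ring.
Qed.

(** For fixed [u] the minimization over [v] decouples into one quadratic per state. *)
Lemma EfunE v u : Efun alpha tau gamma P r v u =
  \sum_s (alpha / 2 * v s ^+ 2 - v s * flux P gamma u s) +
  \sum_s \sum_a u s a * (r s a - tau * ln (u s a / utilde u s)).
Proof.
rewrite /Efun sumrB -sum_mul_cost -mulr_sumr -[tau * _]mulr_sumr2 -!addrA.
congr (_ + _); rewrite [RHS]addrC -!sumrB; apply: eq_bigr => s _.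
rewrite -!sumrB; apply: eq_bigr => a _ /=.
by rewrite /cost; ring.
Qed.

(** No differentiation: passing from [vs] to the exact minimizer [flux us / alpha] changes [E] by
    minus a sum of squares, and the saddle inequality makes this change nonnegative. *)
Lemma saddle_dual_feasible s : alpha * vs s = flux P gamma us s.
Proof.
have [_ [Hv _]] := Hsaddle.
have := Hv (fun s => flux P gamma us s / alpha); rewrite !EfunE lerD2r.
rewrite -subr_ge0 -sumrB.
rewrite (eq_bigr (fun s => - ((alpha * vs s - flux P gamma us s) ^+ 2 / (2 * alpha)))).
  rewrite sumrN oppr_ge0 => h.
  have q0 t : 0 <= (alpha * vs t - flux P gamma us t) ^+ 2 / (2 * alpha).
    by rewrite divr_ge0 ?sqr_ge0// mulr_ge0// ltW.
  have := le_trans (ler_sum_term _ s q0) h.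
  rewrite pmulr_lle0 ?invr_gt0 ?mulr_gt0// => k.
  apply/eqP; rewrite -subr_eq0 -sqrf_eq0.
  by apply/eqP/le_anti; rewrite k sqr_ge0.
by move=> t _; field; rewrite gt_eqF.
Qed.

Let us0 : posu us. Proof. by case: Hsaddle. Qed.

(** The residual of the first order condition in [u]; [saddle_policy] shows that it vanishes. *)
Let G s a := r s a - cost P gamma vs s a - tau * ln (us s a / utilde us s).

(** Up to a constant, [E] at [vs] is the sum of [u (G - tau y)], and [y = 0] at [us]. Replacing the
    weight [u] by [u - us] adds [tau] times the sum of [us y], nonpositive by Gibbs' inequality. *)
Lemma saddle_variation u : posu u ->
  \sum_s \sum_a (u s a - us s a) * (G s a - tau * lratio u us s a) <= 0.
Proof.
move=> u0; have [_ [_ Hu]] := Hsaddle.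
have e u' : Efun alpha tau gamma P r vs u' =
    alpha / 2 * \sum_s vs s ^+ 2 +
    \sum_s \sum_a u' s a * (G s a - tau * lratio u' us s a).
  rewrite /Efun -addrA; congr (_ + _); rewrite -mulr_sumr2 -sumrB.
  apply: eq_bigr => s _; rewrite -sumrB; apply: eq_bigr => a _.
  by rewrite /G /lratio /cost; ring.
have := Hu u u0; rewrite !e lerD2l => h.
have k : \sum_s \sum_a us s a * lratio u us s a <= 0.
  by apply: sumr_le0 => s _; exact: sum_mul_lratio_le0.
have -> : \sum_s \sum_a (u s a - us s a) * (G s a - tau * lratio u us s a) =
  \sum_s \sum_a u s a * (G s a - tau * lratio u us s a) -
  \sum_s \sum_a us s a * (G s a - tau * lratio us us s a) +
  tau * \sum_s \sum_a us s a * lratio u us s a.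
  rewrite -mulr_sumr2 -sumrB -big_split; apply: eq_bigr => s _.
  rewrite /= -sumrB -big_split; apply: eq_bigr => a _.
  by rewrite /= {3}/lratio; ring.
by have : tau * (\sum_s \sum_a us s a * lratio u us s a) <= 0;
  [rewrite pmulr_rle0 | lra].
Qed.

(* Rescale the single entry (s0, a0) by exp x: then lratio at (s0, a0) lies
   between 0 and x. *)
Lemma saddle_variation_entry s0 a0 x : x != 0 ->
  exists2 y, (0 < x -> y <= x) /\ (x < 0 -> x <= y) &
  (expR x - 1) * (G s0 a0 - tau * y) <= 0.
Proof.
move=> x0.
pose u s a := us s a * expR (x * ((s == s0) && (a == a0))%:R).
have u0 : posu u by move=> s a; rewrite mulr_gt0 ?expR_gt0.
exists (lratio u us s0 a0).
  have ut0 := utilde_gt0 _ s0 a0 u0; have ust0 := utilde_gt0 _ s0 a0 us0.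
  have u1 : ln (u s0 a0) = ln (us s0 a0) + x.
    by rewrite /u !eqxx mulr1 lnM ?posrE ?expR_gt0// expRK.
  rewrite /lratio !ln_div ?posrE// u1; split=> hx.
    suff : ln (utilde us s0) <= ln (utilde u s0) by lra.
    rewrite ler_ln ?posrE//; apply: ler_sum => a _.
    rewrite /u ler_peMr ?(ltW (us0 _ _))// -[leLHS]expR0 ler_expR.
    by rewrite mulr_ge0// ltW.
  suff : ln (utilde u s0) <= ln (utilde us s0) by lra.
  rewrite ler_ln ?posrE//; apply: ler_sum => a _.
  rewrite /u ler_piMr ?(ltW (us0 _ _))// -[leRHS]expR0 ler_expR.
  by rewrite mulr_le0_ge0// ltW.
have := saddle_variation u u0.
rewrite (bigD1 s0)//= (bigD1 a0)//= big1 ?addr0; last first.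
  by move=> a /negPf aa0; rewrite /u aa0 andbF mulr0 expR0 mulr1 subrr mul0r.
rewrite big1 ?addr0; last first.
  move=> s /negPf ss0; apply: big1 => a _.
  by rewrite /u ss0 mulr0 expR0 mulr1 subrr mul0r.
rewrite [X in X - _](_ : _ = us s0 a0 * expR x); last by rewrite /u !eqxx mulr1.
rewrite -[X in _ * _ - X]mulr1 -mulrBr -mulrA pmulr_rle0//.
Qed.

(** Variations of either sign give [G <= tau x] for [x > 0] and [G >= tau x] for [x < 0]. Instead of
    a limit at 0, the choice [x = G / (2 tau)] contradicts [G != 0]. *)
Lemma saddle_policy s a :
  tau * ln (us s a / utilde us s) = r s a - cost P gamma vs s a.
Proof.
suff : G s a = 0 by rewrite /G; lra.
have hpos x : 0 < x -> G s a <= tau * x.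
  move=> x0; have [y [/(_ x0) yx _]] := saddle_variation_entry s a x (lt0r_neq0 x0).
  rewrite pmulr_rle0; last by rewrite subr_gt0 -[ltLHS]expR0 ltr_expR.
  by have := ler_wpM2l (ltW Htau) yx; lra.
have hneg x : x < 0 -> tau * x <= G s a.
  move=> x0; have [y [_ /(_ x0) yx]] := saddle_variation_entry s a x (ltr0_neq0 x0).
  rewrite nmulr_rle0; last by rewrite subr_lt0 -[ltRHS]expR0 ltr_expR.
  by have := ler_wpM2l (ltW Htau) yx; lra.
have tE : tau * (G s a / (2 * tau)) = G s a / 2 by field; rewrite gt_eqF.
have [G0|G0|//] := ltgtP (G s a) 0.
  have : G s a / (2 * tau) < 0 by rewrite pmulr_llt0 ?invr_gt0 ?mulr_gt0.
  by move/hneg; rewrite tE; lra.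
have : 0 < G s a / (2 * tau) by rewrite divr_gt0 ?mulr_gt0.
by move/hpos; rewrite tE; lra.
Qed.

End SaddlePoint.

(** * Differentiation rules and Gronwall's inequality *)

Section Derivatives.
Context {R : realType}.
Implicit Types (f g : R -> R) (t c df dg : R).

Lemma is_derive_sumf (I : finType) (h : I -> R -> R) t (dh : I -> R) :
  (forall i, is_derive t 1 (h i) (dh i)) ->
  is_derive t 1 (fun x => \sum_i h i x) (\sum_i dh i).
Proof.
move=> hd; rewrite (_ : (fun x => _) = \sum_i h i); last first.
  by apply/funext => x; rewrite fct_sumE.
by elim/big_ind2 : _ => // [|] *; [exact: is_derive_cst | exact: is_deriveD].
Qed.

Lemma is_derive_mulf f g t df dg :
  is_derive t 1 f df -> is_derive t 1 g dg ->
  is_derive t 1 (fun x => f x * g x) (f t * dg + g t * df).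
Proof. by move=> *; exact: is_deriveM. Qed.

Lemma is_derive_scalef (c : R) f t df :
  is_derive t 1 f df -> is_derive t 1 (fun x => c * f x) (c * df).
Proof. by move=> *; exact: is_deriveZ. Qed.

Lemma is_derive_breg f t df c : 0 < f t -> 0 < c -> is_derive t 1 f df ->
  is_derive t 1 (fun x => breg (f x) c) (df - c * (df / f t)).
Proof.
move=> f0 c0 fd.
have ld : is_derive t 1 (fun x => ln (f x / c)) (df / f t).
  have fc : is_derive t 1 (fun x => c^-1 * f x) (c^-1 * df).
    exact: is_derive_scalef.
  have fc0 : 0 < c^-1 * f t by rewrite mulr_gt0 ?invr_gt0.
  have := @is_derive1_comp R (@ln R) (fun x => c^-1 * f x) t _ _ (is_derive1_ln fc0) fc.
  rewrite (_ : @ln R \o _ = fun x => ln (f x / c)); last first.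
    by apply/funext => x /=; rewrite mulrC.
  by move=> h; apply: is_derive_eq h _; field; rewrite !gt_eqF.
have := @is_deriveB _ _ _ _ _ _ _ _ _
  (@is_deriveB _ _ _ _ _ _ _ _ _ fd (is_derive_cst c t 1))
  (is_derive_scalef c _ _ _ ld).
by rewrite subr0.
Qed.

Lemma is_derive_expRM (c t : R) :
  is_derive t 1 (fun x => expR (c * x)) (c * expR (c * t)).
Proof.
have cd : is_derive t 1 (fun x : R => c * x) (c * 1).
  exact: (is_derive_scalef c id t 1).
have := @is_derive1_comp R expR _ t _ _ (is_derive_expR (c * t)) cd.
by move=> h; apply: is_derive_eq h _; rewrite mulr1 mulrC.
Qed.

Lemma le0_is_derive_nincr f (df : R -> R) x y : x <= y ->
  (forall t, x <= t -> is_derive t 1 f (df t)) ->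
  (forall t, x <= t -> df t <= 0) -> f y <= f x.
Proof.
move=> xy fd df0.
have [||c cxy fE] := @MVT_segment R f df x y xy.
- by move=> t; rewrite in_itv/= => /andP[/ltW xt _]; exact: fd.
- apply: derivable_within_continuous => t; rewrite in_itv/= => /andP[xt _].
  by have [] := fd t xt.
rewrite -subr_le0 fE; move: cxy; rewrite in_itv/= => /andP[xc _].
by rewrite mulr_le0_ge0 ?df0// subr_ge0.
Qed.

(** The integrating factor [expR (c * t)] makes the product nonincreasing. Applied to a negative
    function, as in [lyap_bounded], this bounds earlier values by later ones. *)
Lemma gronwall f (df : R -> R) c x y : x <= y ->
  (forall t, x <= t -> is_derive t 1 f (df t)) ->
  (forall t, x <= t -> df t <= - (c * f t)) ->
  f y <= f x * expR (- (c * (y - x))).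
Proof.
move=> xy fd dfc.
have := @le0_is_derive_nincr (fun t => f t * expR (c * t))
  (fun t => f t * (c * expR (c * t)) + expR (c * t) * df t) x y xy.
have -> : expR (- (c * (y - x))) = expR (c * x) / expR (c * y).
  by rewrite -expRN -expRD; congr expR; ring.
rewrite mulrA ler_pdivlMr ?expR_gt0//; apply=> t xt.
  by apply: is_derive_mulf; [exact: fd | exact: is_derive_expRM].
have := ler_wpM2l (ltW (expR_gt0 (c * t))) (dfc t xt); lra.
Qed.

End Derivatives.

(** * Decay of the energy along trajectories *)

Section Dynamics.
Context {R : realType} {S A : finType}.
Variables (P : S -> A -> S -> R) (r : S -> A -> R) (gamma tau alpha : R).
Hypotheses (HP0 : forall s a s', 0 <= P s a s')
  (HP1 : forall s a, \sum_(s' : S) P s a s' = 1)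
  (Hg0 : 0 < gamma) (Hg1 : gamma < 1) (Htau : 0 < tau) (Halpha : 0 < alpha).
Variables (vs : S -> R) (us : S -> A -> R).
Hypothesis Hsaddle : is_saddle alpha tau gamma P r vs us.

Let us0 : posu us. Proof. by case: Hsaddle. Qed.

(** Solutions live on the open half-line, with two-sided derivatives; nothing is assumed about a
    limit at 0+. *)
Definition trajectory (v : R -> S -> R) (u : R -> S -> A -> R) : Prop :=
  [/\ forall t : R, 0 < t -> posu (u t),
      forall t : R, 0 < t -> forall s,
        is_derive t (1:R) (fun x : R => v x s) (vfield alpha gamma P (v t) (u t) s) &
      forall t : R, 0 < t -> forall s a,
        is_derive t (1:R) (fun x : R => u x s a) (ufield tau gamma P r (v t) (u t) s a)].

Definition vdev (v : S -> R) s := v s - vs s.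

Implicit Types t x y : R.

Lemma fluxB (d d' : S -> A -> R) s : flux P gamma (fun s a => d s a - d' s a) s =
  flux P gamma d s - flux P gamma d' s.
Proof.
rewrite /flux -sumrB; apply: eq_bigr => t _; rewrite -sumrB.
by apply: eq_bigr => a _; rewrite mulrBr.
Qed.

Lemma costB (w w' : S -> R) s a : cost P gamma (fun s => w s - w' s) s a =
  cost P gamma w s a - cost P gamma w' s a.
Proof. by rewrite /cost -sumrB; apply: eq_bigr => t _; rewrite mulrBr. Qed.

Lemma vfieldE v u s : vfield alpha gamma P v u s =
  - (vdev v s - flux P gamma (dev us u) s / alpha).
Proof.
rewrite /vfield /vdev /dev fluxB -(saddle_dual_feasible _ _ _ _ _ _ _ Halpha Hsaddle).
by rewrite -/(flux P gamma u s); field; rewrite gt_eqF.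
Qed.

Lemma ufieldE v u s a : ufield tau gamma P r v u s a =
  - (u s a * (lratio u us s a + cost P gamma (vdev v) s a / tau)).
Proof.
rewrite /ufield /lratio /vdev costB.
have h := saddle_policy P r gamma tau alpha vs us Htau Hsaddle s a.
have -> : ln (us s a / utilde us s) = (r s a - cost P gamma vs s a) / tau.
  by rewrite -h; field; rewrite gt_eqF.
by rewrite -/(cost P gamma v s a); field; rewrite gt_eqF.
Qed.

Section Trajectory.
Variables (v : R -> S -> R) (u : R -> S -> A -> R).
Hypothesis traj : trajectory v u.

Let L (t : R) := lyap tau alpha us (vdev (v t)) (u t).

Let u0 (t : R) : 0 < t -> posu (u t). Proof. by case: traj => + _ _; apply. Qed.

Lemma is_derive_vdev t s : 0 < t -> is_derive t (1:R) (fun x : R => vdev (v x) s)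
  (- (vdev (v t) s - flux P gamma (dev us (u t)) s / alpha)).
Proof.
move=> t0; case: traj => _ vd _.
have := @is_deriveB _ _ _ _ _ _ _ _ _ (vd t t0 s) (is_derive_cst (vs s) t 1).
by rewrite subr0 vfieldE.
Qed.

(** The quadratic part contributes [+ <w, q>] and the entropy part [- <w, q>]: the weights [alpha]
    and [tau] in [lyap] make the coupling cancel. *)
Lemma is_derive_lyap t : 0 < t ->
  is_derive t (1:R) L (- dissip tau alpha us (vdev (v t)) (u t)).
Proof.
move=> t0; case: (traj) => _ _ ud.
have wd : is_derive t (1:R) (fun x : R => alpha / 2 * \sum_s vdev (v x) s ^+ 2)
    (alpha / 2 * \sum_s (vdev (v t) s *
      - (vdev (v t) s - flux P gamma (dev us (u t)) s / alpha) + vdev (v t) s *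
      - (vdev (v t) s - flux P gamma (dev us (u t)) s / alpha))).
  apply: is_derive_scalef; apply: is_derive_sumf => s.
  by apply: is_derive_mulf; exact: is_derive_vdev.
have bd : is_derive t (1:R) (fun x : R => tau * \sum_s \sum_a breg (u x s a) (us s a))
    (tau * \sum_s \sum_a (ufield tau gamma P r (v t) (u t) s a -
       us s a * (ufield tau gamma P r (v t) (u t) s a / u t s a))).
  apply: is_derive_scalef; apply: is_derive_sumf => s; apply: is_derive_sumf => a.
  by apply: is_derive_breg; [exact: u0 | exact: us0 | exact: ud].
apply: is_derive_eq (is_deriveD wd bd) _.
have -> : tau * \sum_s \sum_a (ufield tau gamma P r (v t) (u t) s a -
       us s a * (ufield tau gamma P r (v t) (u t) s a / u t s a)) =
    - (tau * \sum_s \sum_a dev us (u t) s a * lratio (u t) us s a) -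
    \sum_s vdev (v t) s * flux P gamma (dev us (u t)) s.
  rewrite -sum_mul_cost -!mulr_sumr2 -sumrN -sumrB; apply: eq_bigr => s _.
  rewrite -sumrN -sumrB; apply: eq_bigr => a _.
  by rewrite ufieldE /dev; field; rewrite !gt_eqF// u0.
rewrite /dissip.
suff -> : alpha / 2 * \sum_s (vdev (v t) s *
      - (vdev (v t) s - flux P gamma (dev us (u t)) s / alpha) + vdev (v t) s *
      - (vdev (v t) s - flux P gamma (dev us (u t)) s / alpha)) =
    - (alpha * \sum_s vdev (v t) s ^+ 2) +
    \sum_s vdev (v t) s * flux P gamma (dev us (u t)) s by ring.
rewrite !mulr_sumr -sumrN -big_split.
by apply: eq_bigr => s _ /=; field; rewrite gt_eqF.
Qed.

Lemma is_derive_cross t : 0 < t ->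
  is_derive t (1:R) (fun x : R => cross P gamma us (vdev (v x)) (u x))
    (cross_rate P gamma tau alpha us (vdev (v t)) (u t)).
Proof.
move=> t0; case: (traj) => _ _ ud.
have qd s' : is_derive t (1:R) (fun x : R => flux P gamma (dev us (u x)) s')
    (flux P gamma (ufield tau gamma P r (v t) (u t)) s').
  apply: is_derive_sumf => s; apply: is_derive_sumf => a.
  apply: is_derive_scalef.
  have := @is_deriveB _ _ _ _ _ _ _ _ _ (ud t t0 s a) (is_derive_cst (us s a) t 1).
  by rewrite subr0.
have := is_deriveN (is_derive_sumf _ _ _ _
  (fun s => is_derive_mulf _ _ _ _ _ (is_derive_vdev t s t0) (qd s))).
move=> h; apply: is_derive_eq h _; rewrite big_split/= -sum_mul_cost opprD addrC.
rewrite /cross_rate; congr (_ + _).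
  rewrite mulr_suml -sumrN -sumrB; apply: eq_bigr => s _.
  by ring.
rewrite -sumrN; apply: eq_bigr => s _; rewrite -sumrN; apply: eq_bigr => a _.
by rewrite ufieldE; ring.
Qed.

Lemma lyap_nincr x y : 0 < x -> x <= y -> L y <= L x.
Proof.
move=> x0 xy; apply: (@le0_is_derive_nincr _ L
  (fun t => - dissip tau alpha us (vdev (v t)) (u t))) => // t xt.
  by apply: is_derive_lyap; lra.
rewrite oppr_le0; apply: dissip_ge0 => //; apply: u0; lra.
Qed.

(* The dissipation is at most linear in the energy, so no trajectory on the
   open half-line blows up at 0+. *)
Lemma lyap_bounded : exists2 M, 0 < M & forall t : R, 0 < t -> L t <= M.
Proof.
have [C C0 dC] := dissip_le_lyap tau alpha us Htau Halpha us0.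
have L10 : 0 <= L 1 by apply: lyap_ge0 => //; exact: u0.
exists ((1 + L 1) * expR C) => [|t t0]; first by rewrite mulr_gt0 ?expR_gt0; lra.
have [t1|t1] := leP 1 t.
  apply: le_trans (lyap_nincr _ _ ltr01 t1) _.
  apply: (@le_trans _ _ (1 + L 1)); first lra.
  by rewrite ler_peMr; [| lra | rewrite -[leLHS]expR0 ler_expR ltW].
(* Gronwall for this negative function runs the estimate backward from time 1. *)
pose g (x : R) := - (1 + L x).
have gd x : t <= x -> is_derive x (1:R) g (dissip tau alpha us (vdev (v x)) (u x)).
  move=> tx; have x0 : 0 < x by lra.
  have := is_deriveN (is_deriveD (is_derive_cst (1 : R) x (1 : R)) (is_derive_lyap x x0)).
  by rewrite add0r opprK.
have := @gronwall _ g _ C t 1 (ltW t1) gd.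
have gC x : t <= x ->
    dissip tau alpha us (vdev (v x)) (u x) <= - (C * g x).
  by move=> tx; rewrite /g mulrN opprK; apply: dC; apply: u0; lra.
move=> /(_ gC); rewrite /g mulNr lerN2 expRN.
rewrite ler_pdivrMr ?expR_gt0// => h.
apply: (@le_trans _ _ ((1 + L 1) * expR (C * (1 - t)))); first lra.
rewrite ler_pM2l; last lra.
by rewrite ler_expR ler_piMr ?(ltW C0)//; lra.
Qed.

End Trajectory.

(** Monotonicity of [lyap] keeps the trajectory in the sublevel set, so [hypocoercivity] applies at
    all later times. The modified energy lies between [L / 2] and [3 L / 2], whence the factor 3. *)
Lemma lyap_decay M : exists2 c, 0 < c & forall v u, trajectory v u ->
  forall t0 : R, 0 < t0 -> lyap tau alpha us (vdev (v t0)) (u t0) <= M ->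
  forall t : R, t0 <= t -> lyap tau alpha us (vdev (v t)) (u t) <=
    3 * lyap tau alpha us (vdev (v t0)) (u t0) * expR (- (c * (t - t0))).
Proof.
have [eps [c [eps0 c0 H]]] :=
  hypocoercivity P gamma tau alpha us HP0 HP1 Hg0 Hg1 Htau Halpha us0 M.
exists (c / 2) => [|v u traj t0 t00 LM t tt0]; first by rewrite divr_gt0.
set L := fun t : R => lyap tau alpha us (vdev (v t)) (u t).
set X := fun t : R => cross P gamma us (vdev (v t)) (u t).
have pos x : t0 <= x -> posu (u x) by case: traj => + _ _ tx; apply; lra.
have LM' x : t0 <= x -> L x <= M.
  by move=> tx; apply: le_trans LM; exact: lyap_nincr.
have L0 x : t0 <= x -> 0 <= L x by move=> tx; apply: lyap_ge0 => //; exact: pos.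
have XL x : t0 <= x -> - (L x / 2) <= eps * X x <= L x / 2.
  by move=> tx; rewrite -ler_norml; case: (H _ _ (pos x tx) (LM' x tx)).
pose dF x := - dissip tau alpha us (vdev (v x)) (u x) +
  eps * cross_rate P gamma tau alpha us (vdev (v x)) (u x).
have Fd x : t0 <= x -> is_derive x (1:R) (fun x => L x + eps * X x) (dF x).
  move=> tx; apply: is_deriveD; first by apply: is_derive_lyap => //; lra.
  by apply: is_derive_scalef; apply: is_derive_cross => //; lra.
have FdF x : t0 <= x -> dF x <= - (c / 2 * (L x + eps * X x)).
  move=> tx; have [_] := H _ _ (pos x tx) (LM' x tx); rewrite -/(L x) => d.
  have /andP[_] := XL x tx; rewrite -(ler_pM2l c0) /dF.
  by have := mulr_ge0 (ltW c0) (L0 x tx); lra.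
have h := gronwall _ _ _ _ _ tt0 Fd FdF.
have /andP[h1 _] := XL t tt0; have /andP[_ h2] := XL t0 (lexx t0).
rewrite -/(L t) -/(L t0).
have e0 := expR_gt0 (- (c / 2 * (t - t0))).
have : (L t0 + eps * X t0) * expR (- (c / 2 * (t - t0))) <=
    3 / 2 * L t0 * expR (- (c / 2 * (t - t0))) by rewrite ler_pM2r//; lra.
lra.
Qed.

Lemma lyap_exp_decay : exists2 c, 0 < c & forall v u, trajectory v u ->
  exists2 C, 0 < C & forall t : R, 0 < t ->
  lyap tau alpha us (vdev (v t)) (u t) <= C * expR (- (c * t)).
Proof.
(* This rate, for the level 1, is chosen before the trajectory; [M] and [c'] depend on the
   trajectory and enter only the prefactor. *)
have [c c0 Hc] := lyap_decay 1; exists c => // v u traj.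
have [M M0 LM] := lyap_bounded v u traj.
have [c' c'0 Hc'] := lyap_decay M.
set L := fun t : R => lyap tau alpha us (vdev (v t)) (u t).
(* Chosen so that [c' (t1 - 1) = 3 M]; then [3 M <= e^(3 M)] brings the energy below 1. *)
pose t1 := 1 + 3 * M / c'.
have t11 : 1 <= t1 by rewrite lerDl divr_ge0 ?mulr_ge0// ltW.
have L1 : L t1 <= 1.
  apply: le_trans (Hc' v u traj 1 ltr01 (LM 1 ltr01) t1 t11) _.
  rewrite expRN ler_pdivrMr ?expR_gt0// mul1r.
  apply: (@le_trans _ _ (3 * M)); first by rewrite ler_pM2l// LM.
  rewrite (_ : c' * _ = 3 * M); last by rewrite /t1; field; rewrite gt_eqF.
  by have := expR_ge1Dx (3 * M); lra.
have L0 t : 0 < t -> 0 <= L t.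
  by move=> t0; apply: lyap_ge0 => //; case: traj => + _ _; apply.
(* Before [t1] the bound [M] suffices, as [expR (c * t1)] outweighs the decay; after [t1] the
   prefactor is 3. *)
exists ((3 + M) * expR (c * t1)) => [|t t0].
  by rewrite mulr_gt0 ?expR_gt0//; lra.
rewrite -mulrA -expRD; have [tt1|tt1] := leP t1 t.
  have t10 : 0 < t1 by lra.
  apply: le_trans (Hc v u traj t1 t10 L1 t tt1) _.
  rewrite (_ : c * t1 - c * t = - (c * (t - t1))); last by ring.
  by rewrite ler_pM2r ?expR_gt0// -/(L t1); lra.
apply: le_trans (LM t t0) _.
apply: (@le_trans _ _ (3 + M)); first lra.
rewrite ler_peMr; [by [] | lra |].
by rewrite -[leLHS]expR0 ler_expR subr_ge0 ler_pM2l// ltW.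
Qed.

End Dynamics.

(** * From decay of the energy to convergence in l1 norm *)

Theorem theorem2p5 (R : realType) (S A : finType)
  (P : S -> A -> S -> R) (r : S -> A -> R) (gamma tau alpha : R)
  (HP0 : forall s a s', 0 <= P s a s')
  (HP1 : forall s a, \sum_(s' : S) P s a s' = 1)
  (Hr : forall s a, 0 <= r s a)
  (Hg0 : 0 < gamma) (Hg1 : gamma < 1) (Htau : 0 < tau) (Halpha : 0 < alpha)
  (vs : S -> R) (us : S -> A -> R)
  (Hsaddle : is_saddle alpha tau gamma P r vs us) :
  exists c : R, 0 < c /\
  forall (v : R -> S -> R) (u : R -> S -> A -> R),
    (forall t : R, 0 < t -> forall s a, 0 < u t s a) ->
    (forall t : R, 0 < t -> forall s',
       is_derive t (1:R) (fun x : R => v x s') (vfield alpha gamma P (v t) (u t) s')) ->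
    (forall t : R, 0 < t -> forall s a,
       is_derive t (1:R) (fun x : R => u x s a) (ufield tau gamma P r (v t) (u t) s a)) ->
    exists C : R, forall t : R, 0 < t ->
      \sum_(s : S) `|v t s - vs s| + \sum_(s : S) \sum_(a : A) `|u t s a - us s a|
        <= C * expR (- (c * t)).
Proof.
have us0 : posu us by case: Hsaddle.
have [c c0 Hc] := lyap_exp_decay P r gamma tau alpha HP0 HP1 Hg0 Hg1 Htau Halpha
  vs us Hsaddle.
(* The energy controls squares of the deviations, so the rate is halved. *)
exists (c / 2); split=> [|v u u0 vd ud]; first by rewrite divr_gt0.
have traj : trajectory P r gamma tau alpha v u by split.
have [C C0 LC] := Hc v u traj.
have [m [U [m0 U0 mUP]]] := sublevel_bounds tau alpha us Htau Halpha us0 C.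
(* Each squared deviation is at most [B] times the energy, by [sum_sqr_le_lyap] for [v] and
   [sum_dev_sqr_le_lyap] for [u]. *)
pose B := 2 / alpha + 4 * U / tau.
have B0 : 0 < B by rewrite addr_gt0 ?divr_gt0 ?mulr_gt0.
have BC0 : 0 < B * C by rewrite mulr_gt0.
pose N : R := #|S|%:R + (#|S| * #|A|)%:R.
(* [N] counts the terms, and [1 + B * C] stands in for the square root of [B * C]. *)
exists (N * (1 + B * C)) => t t0.
have e0 := expR_gt0 (- (c / 2 * t)).
have eE : expR (- (c * t)) = expR (- (c / 2 * t)) * expR (- (c / 2 * t)).
  by rewrite -expRD; congr expR; lra.
have ec1 : expR (- (c * t)) <= 1.
  by rewrite -[leRHS]expR0 ler_expR oppr_le0 mulr_ge0// ltW.
have LCt := LC t t0; set Lt := lyap _ _ _ _ _ in LCt.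
have LtC : Lt <= C by apply: le_trans LCt _; rewrite ler_piMr// ltW.
have Lt0 : 0 <= Lt by apply: lyap_ge0 => //; exact: u0.
have [_ _ _ uU usU] := mUP _ _ (u0 t t0) LtC.
have small x : x ^+ 2 <= B * Lt ->
    `|x| <= (1 + B * C) * expR (- (c / 2 * t)).
  move=> xB; rewrite -(@ler_sqr _ `|x|) ?nnegrE//; last first.
    by rewrite mulr_ge0 ?(ltW e0)// addr_ge0// ltW.
  rewrite real_normK ?num_real//; apply: le_trans xB _.
  apply: (@le_trans _ _ (B * (C * expR (- (c * t))))); first by rewrite ler_pM2l.
  by rewrite mulrA exprMn eE -expr2 ler_pM2r ?exprn_gt0//; nra.
have hv s : `|v t s - vs s| <= (1 + B * C) * expR (- (c / 2 * t)).
  apply: small; apply: (@le_trans _ _ (2 * Lt / alpha)).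
    rewrite ler_pdivlMr// mulrC.
    apply: le_trans (sum_sqr_le_lyap tau alpha us Htau us0 _ _ (u0 t t0)).
    rewrite ler_pM2l//; apply: (ler_sum_term (fun s => (v t s - vs s) ^+ 2)).
    by move=> ?; exact: sqr_ge0.
  have : 0 <= 4 * U / tau * Lt by rewrite !mulr_ge0 ?invr_ge0// ltW.
  by rewrite /B; lra.
have hu s a : `|u t s a - us s a| <= (1 + B * C) * expR (- (c / 2 * t)).
  apply: small; apply: (@le_trans _ _ (4 * U * Lt / tau)).
    rewrite ler_pdivlMr// mulrC.
    apply: le_trans (sum_dev_sqr_le_lyap tau alpha us Htau Halpha us0 _ _ U
      (ltW U0) (u0 t t0) uU usU).
    rewrite ler_pM2l//; apply: (ler_sum2_term (fun s a => dev us (u t) s a ^+ 2)).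
    by move=> ? ?; exact: sqr_ge0.
  have : 0 <= 2 / alpha * Lt by rewrite !mulr_ge0 ?invr_ge0// ltW.
  by rewrite /B; lra.
rewrite /N mulrDl mulrDl; apply: lerD.
  apply: le_trans (ler_sum _ (fun s _ => hv s)) _.
  by rewrite sumr_const -[leRHS]mulrA [leRHS]mulr_natl.
apply: le_trans (ler_sum2 _ _ hu) _.
by rewrite sum_const2 -[leRHS]mulrA.
Qed.
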